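(* Let $(d_i)_{i\ge 0}$ be a sequence of integers with $d_i\ge 2$, and let $A,B$ be $\{d_i\}$-collections. Then $\mathrm{span}(A)=\mathrm{span}(B)$ if and only if $\mathrm{norm}(A)=\mathrm{norm}(B)$.
   Context: Put $p_0=1$ and $p_{i+1}=d_ip_i$ for $i\ge 0$. A $\{d_i\}$-collection is a finite multiset of numbers $p_i$, written $A=(a_0,a_1,\ldots,a_k)$ with $a_i\in\mathbb{Z}_{\ge 0}$ and $a_k\ne 0$, where $a_i$ is the multiplicity of $p_i$ in $A$; put $a_i=0$ for $i>k$. $\mathrm{span}(A)=\{\sum_{i=0}^k c_ip_i : c_i\in\mathbb{Z},\ 0\le c_i\le a_i\}$, i.e. the set of sums of all submultisets of $A$. If $a_i\ge d_i$, the elementary exchange $e_i$ replaces $a_i$ by $a_i-d_i$ and $a_{i+1}$ by $a_{i+1}+1$. The normalization $\mathrm{norm}(A)$ is the $\{d_i\}$-collection obtained from $A$ by the following procedure: for $i=0,1,2,\ldots$ in this order, as long as the current multiplicity $a_i$ satisfies $a_i>2(d_i-1)$, apply $e_i$ to the current collection; then pass to $i+1$; stop when all nonzero places of the current collection have been traversed. *)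

(* Defs.v *)
From mathcomp Require Import all_boot.
From mathcomp Require Import finmap multiset.
From mathcomp Require Import classical_sets.
From mathcomp Require Import zify.

Set Implicit Arguments.
Unset Strict Implicit.
Unset Printing Implicit Defensive.

Local Open Scope fset_scope.
Local Open Scope mset_scope.
Local Open Scope nat_scope.

Fixpoint place_value (d : nat -> nat) (i : nat) : nat :=
  if i is j.+1 then d j * place_value d j else 1.

(* A {d_i}-collection is stored as the finite multiset of the indices i of its
   members p_i: since d_i >= 2 the p_i are pairwise distinct, so [A i] is the
   multiplicity a_i of p_i, and [A i = 0] for all i beyond the last place. *)
Notation collection := {mset nat}.

Definition span (d : nat -> nat) (A : collection) : set nat :=
  [set x | exists2 c : nat -> nat,
     (forall i, c i <= A i) &
     x = \sum_(i <- finsupp A) c i * place_value d i]%classic.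

(* The elementary exchange e_i; meaningful only when [d i <= A i]. *)
Definition exchange (d : nat -> nat) (i : nat) (A : collection) : collection :=
  i.+1 +` (A `\` msetn (d i) i).

(* In a state [(i, A)] of the procedure, A is the current collection and the
   places below i have been traversed. *)
Definition norm_done (s : nat * collection) : bool :=
  all (fun j => j < s.1) (finsupp s.2).

Definition norm_step (d : nat -> nat) (s : nat * collection) :
    nat * collection :=
  let: (i, A) := s in
  if norm_done s then s
  else if 2 * (d i - 1) < A i then (i, exchange d i A)
  else (i.+1, A).

(* An upper bound on the number of steps from [(0, A)]; see [norm_stops]. *)
Definition norm_fuel (A : collection) : nat :=
  2 * size A + \max_(i <- finsupp A) i.+1.

Definition norm_run (d : nat -> nat) (A : collection) : nat * collection :=
  iter (norm_fuel A) (norm_step d) (0, A).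

Definition norm (d : nat -> nat) (A : collection) : collection :=
  (norm_run d A).2.

Lemma exchangeE d i (A : collection) j :
  exchange d i A j = (j == i.+1) + (A j - (if j == i then d i else 0)).
Proof. by rewrite /exchange mset1DE msetE2 msetnE. Qed.

Lemma size_exchange d i (A : collection) : d i <= A i ->
  size (exchange d i A) + d i = (size A).+1.
Proof.
move=> dA; rewrite -[X in _ + X](size_nseq _ i) -size_cat -[RHS]/(size (i.+1 :: A)).
apply/perm_size/allP => j _ /=; rewrite count_cat count_nseq /= !count_mem_mset.
rewrite exchangeE -addnA [i.+1 == j]eq_sym; apply/eqP; congr (_ + _).
by rewrite [i == j]eq_sym; case: eqP => [->|_]; rewrite ?mul1n ?subnK ?subn0 ?addn0.
Qed.

(* Each step before the stop decreases this quantity: the place added by an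
   exchange is paid for by the fall in cardinality. *)
Definition norm_potential (s : nat * collection) : nat :=
  2 * size s.2 + (\max_(j <- finsupp s.2) j.+1 - s.1).

Lemma norm_potential_step d s : (forall i, 2 <= d i) -> ~~ norm_done s ->
  norm_potential (norm_step d s) < norm_potential s.
Proof.
case: s => i A hd nd; rewrite /norm_step (negbTE nd) /norm_potential.
have lt_i : i < \max_(j <- finsupp A) j.+1.
  move: nd; rewrite -has_predC => /hasP[j jA /=]; rewrite -leqNgt => le_ij.
  have /(_ isT) := @leq_bigmax_seq nat (enum_fset (finsupp A)) xpredT (fun j => j.+1) j jA.
  exact: leq_trans.
case: ifP => [lt_A | _] /=; last by rewrite ltn_add2l ltn_sub2l.
have dA : d i <= A i by have := hd i; lia.
have := size_exchange dA; clear lt_A dA; have := hd i.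
have : \max_(j <- finsupp (exchange d i A)) j.+1
       <= (\max_(j <- finsupp A) j.+1).+1.
  apply/bigmax_leqP_seq => j; rewrite msuppE in_mset exchangeE => jE _.
  have [->|ne_j] := eqVneq j i.+1; first by lia.
  have jA : j \in finsupp A.
    by rewrite msuppE in_mset; move: jE; rewrite (negbTE ne_j); lia.
  exact/leqW/(@leq_bigmax_seq nat (enum_fset (finsupp A)) xpredT (fun j => j.+1) j jA).
move: lt_i; move: (\max_(j <- finsupp A) _) (\max_(j <- finsupp (exchange _ _ _)) _).
move: (size A) (size (exchange d i A)) (d i) => *; clear hd nd; lia.
Qed.

Lemma norm_stops d A : (forall i, 2 <= d i) -> norm_done (norm_run d A).
Proof.
move=> hd; rewrite /norm_run.
have: norm_potential (0, A) <= norm_fuel A by rewrite /norm_potential subn0.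
elim: (norm_fuel A) (0, A) => [|n IHn] s le_s.
  by apply: contraT => nd; have := leq_trans (norm_potential_step hd nd) le_s.
rewrite iterSr; have [sd|nd] := boolP (norm_done s); last first.
  by apply: IHn; rewrite -ltnS; apply: leq_trans (norm_potential_step hd nd) le_s.
have fixs : norm_step d s = s by case: s sd {le_s} => i B /= ->.
by rewrite fixs; elim: n {IHn le_s} => [|n IHn] //; rewrite iterSr fixs.
Qed.

(* Main.v *)
Require Import Defs.
From mathcomp Require Import all_boot.
From mathcomp Require Import finmap multiset.
From mathcomp Require Import classical_sets.
From mathcomp Require Import zify.

(** The forward and backward implications rest on two facts: an exchange made
    by the procedure never changes the span ([span_exchange]), so
    [span d (norm d A) = span d A]; and a collection whose multiplicities all
    satisfy [a_i <= 2 (d_i - 1)], as those of a normalization do, is determined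
    by its span ([reachable_inj]).

    The exchange at place i is made only when [a_i >= 2 d_i - 1], so that it
    leaves at least [d_i - 1] copies of [p_i].  A sum using more copies of [p_i]
    than are left therefore uses at least [d_i] of them, and may trade these for
    the new copy of [p_(i+1)]; a sum using the new copy of [p_(i+1)] may trade
    it back.

    For the second fact the places are read off from the lowest one upwards.
    All members but those at place 0 are multiples of [d_0].  So the elements of
    the span below [d_0] give [min(a_0, d_0 - 1)], and its largest element gives
    [a_0] modulo [d_0]; as [a_0 <= 2 d_0 - 2], together they give [a_0].
    Moreover, with [r = min(a_0, d_0 - 1)], the only [c <= a_0] congruent to [r]
    modulo [d_0] is [r] itself.  Hence [r + d_0 y] is in the span exactly when
    [y] is in the span of the collection of higher places divided by [d_0],
    which is a collection for the shifted sequence [d_1, d_2, ...], and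
    induction applies. *)

Set Implicit Arguments.
Unset Strict Implicit.
Unset Printing Implicit Defensive.

Local Open Scope nat_scope.

(** * Spans as sums over an initial segment of places *)

Definition value (d : nat -> nat) (n : nat) (c : nat -> nat) : nat :=
  \sum_(i < n) c i * place_value d i.

Definition reachable (d : nat -> nat) (n : nat) (a : nat -> nat) (x : nat) :=
  exists2 c : nat -> nat, (forall i, c i <= a i) & x = value d n c.

Lemma mset_bound (A : collection) : exists n, forall i, n <= i -> A i = 0.
Proof.
exists (\max_(i <- finsupp A) i.+1) => i le_i.
apply/eqP; apply: contraTT le_i; rewrite -lt0n -in_mset -msuppE -ltnNge => iA.
exact: (@leq_bigmax_seq nat (enum_fset (finsupp A)) xpredT (fun j => j.+1) i iA).
Qed.

(** Sums over an initial segment allow collections of different supports to be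
    compared term by term. *)
Lemma spanP d n (A : collection) x : (forall i, n <= i -> A i = 0) ->
  span d A x <-> reachable d n A x.
Proof.
move=> An0.
suff sumE c : (forall i, c i <= A i) ->
    \sum_(i <- finsupp A) c i * place_value d i = value d n c.
  by split=> -[c cA ->]; exists c => //; rewrite sumE.
move=> cA; rewrite /value -(big_mkord xpredT (fun i => c i * place_value d i)).
rewrite [RHS](bigID (mem (finsupp A))) /= [X in _ = _ + X]big1 ?addn0; last first.
  move=> i; rewrite msuppE in_mset -leqNgt leqn0 => /eqP Ai0.
  by move: (cA i); rewrite Ai0 leqn0 => /eqP ->.
rewrite -[RHS]big_filter; apply/perm_big/uniq_perm; rewrite ?fset_uniq //.
  exact/filter_uniq/iota_uniq.
move=> i; rewrite mem_filter mem_index_iota /=.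
case iA: (i \in finsupp A) => //=; symmetry; rewrite ltnNge.
by apply: contraTN iA => /An0; rewrite msuppE in_mset => ->.
Qed.

(** * Exchanges preserve the span *)

Lemma value_add_at d n c k m : k < n ->
  value d n (fun j => c j + (if j == k then m else 0))
  = value d n c + m * place_value d k.
Proof.
move=> lt_kn; rewrite /value; under eq_bigr do rewrite mulnDl.
rewrite big_split /=; congr (_ + _); rewrite (bigD1 (Ordinal lt_kn)) //= eqxx.
rewrite big1 ?addn0 // => j ne_jk.
have /negbTE -> // : (j : nat) != k by [].
Qed.

Lemma value_carry d n c i : i.+1 < n ->
  value d n (fun j => c j + (if j == i then d i else 0))
  = value d n (fun j => c j + (if j == i.+1 then 1 else 0)).
Proof. by move=> lt_in; rewrite !value_add_at ?mul1n // ltnW. Qed.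

Lemma eq_value d n c c' : c =1 c' -> value d n c = value d n c'.
Proof. by move=> cc'; apply: eq_bigr => i _; rewrite cc'. Qed.

Lemma span_exchange d i (A : collection) : 2 <= d i -> 2 * (d i - 1) < A i ->
  span d (exchange d i A) = span d A.
Proof.
move=> hd lt_A; have [n0 An0] := mset_bound A.
pose n := maxn n0 i.+2.
have lt_in : i.+1 < n by rewrite /n; lia.
have An j : n <= j -> A j = 0 by move=> le_nj; apply: An0; move: le_nj; rewrite /n; lia.
have En j : n <= j -> exchange d i A j = 0.
  move=> le_nj; rewrite exchangeE An // sub0n addn0.
  by case: eqP => // ej; lia.
apply/seteqP; split=> x; rewrite (spanP _ _ En) (spanP _ _ An) => -[c cE ->].
- have cE' j : c j <= (j == i.+1) + (A j - (if j == i then d i else 0)).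
    by rewrite -exchangeE.
  have [le_c|lt_c] := leqP (c i.+1) (A i.+1).
    exists c => // j; have [->//|ne_j] := eqVneq j i.+1.
    by move: (cE' j); rewrite (negbTE ne_j); lia.
  pose c0 j := if j == i.+1 then c j - 1 else c j.
  exists (fun j => c0 j + (if j == i then d i else 0)).
    move=> j; move: (cE' j); rewrite /c0.
    have [->|ne_j] := eqVneq j i.+1; first by case: eqP => [|_]; lia.
    by have [->|ne_ji] := eqVneq j i; lia.
  rewrite value_carry //; apply: eq_value => j; rewrite /c0.
  by case: eqP => [->|_]; lia.
- have [le_c|lt_c] := leqP (c i) (A i - d i).
    exists c => // j; rewrite exchangeE.
    by have := cE j; have [->|_] := eqVneq j i; lia.
  pose c0 j := if j == i then c j - d i else c j.
  exists (fun j => c0 j + (if j == i.+1 then 1 else 0)).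
    move=> j; move: (cE j); rewrite exchangeE /c0.
    have [->|ne_j] := eqVneq j i; first by case: eqP => [|_]; lia.
    by case: eqP; lia.
  rewrite -value_carry //; apply: eq_value => j; rewrite /c0.
  (* More than a_i - d_i >= d_i - 1 copies are used, so subtraction is exact. *)
  by case: eqP => [->|_]; lia.
Qed.

(** * The normalization: same span, small multiplicities *)

Definition normal (d a : nat -> nat) := forall i, a i <= 2 * (d i - 1).

Lemma span_norm d (A : collection) : (forall i, 2 <= d i) ->
  span d (norm d A) = span d A.
Proof.
move=> hd; rewrite /norm /norm_run.
elim: (norm_fuel A) => [//|n <-]; rewrite iterS.
case: (iter _ _ _) => i B; rewrite /norm_step.
by case: ifP => // _; case: ifP => //= lt_B; rewrite span_exchange.
Qed.

(** An exchange at place i alters only the places i and i+1, so places that have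
    been traversed stay small. *)
Lemma normal_norm d (A : collection) : (forall i, 2 <= d i) ->
  normal d (norm d A).
Proof.
move=> hd j; rewrite /norm.
have small : forall k, k < (norm_run d A).1 -> (norm_run d A).2 k <= 2 * (d k - 1).
  rewrite /norm_run; elim: (norm_fuel A) => [//|n]; rewrite iterS.
  case: (iter _ _ _) => i B /= IHn; case: ifP => // _; case: ifP => /= cmp k lt_k.
    rewrite exchangeE (ltn_eqF lt_k) (ltn_eqF (leqW lt_k)) subn0.
    exact: IHn.
  have [->|ne_k] := eqVneq k i; first by rewrite leqNgt cmp.
  by apply: IHn; lia.
have [/small//|le_j] := ltnP j (norm_run d A).1.
have/allP/(_ j) stop := norm_stops A hd.
case jN: (j \in finsupp (norm_run d A).2); first by have := stop jN; lia.
by move: jN; rewrite msuppE in_mset; lia.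
Qed.

(** * A small collection is determined by its span *)

Definition shift (f : nat -> nat) (i : nat) := f i.+1.

Lemma place_valueS d i : place_value d i.+1 = d 0 * place_value (shift d) i.
Proof.
elim: i => [//|i IHi].
by rewrite -[LHS]/(d i.+1 * place_value d i.+1) IHi mulnCA.
Qed.

Lemma valueS d n c : value d n.+1 c = c 0 + d 0 * value (shift d) n (shift c).
Proof.
rewrite /value big_ord_recl muln1 big_distrr; congr (_ + _).
by apply: eq_bigr => i _; rewrite lift0 place_valueS mulnCA.
Qed.

Lemma reachableS d n a x :
  reachable d n.+1 a x <->
  exists c0 y, [/\ c0 <= a 0, reachable (shift d) n (shift a) y & x = c0 + d 0 * y].
Proof.
split=> [[c ca ->]|[c0 [y [c0a [c ca ->] ->]]]].
  exists (c 0), (value (shift d) n (shift c)); split=> //; last exact: valueS.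
  by exists (shift c) => // i; apply: ca.
exists (fun i => if i is j.+1 then c j else c0); first by case.
by rewrite valueS.
Qed.

Lemma reachable_max d n a : reachable d n a (value d n a).
Proof. by exists a. Qed.

Lemma reachable_le_max d n a x : reachable d n a x -> x <= value d n a.
Proof. by case=> c ca ->; apply: leq_sum => i _; rewrite leq_mul2r ca orbT. Qed.

Lemma reachable0 d n a : reachable d n a 0.
Proof. by exists (fun=> 0) => //; rewrite /value big1. Qed.

Lemma reachable_small d n a x : x < d 0 ->
  reachable d n.+1 a x <-> x <= a 0.
Proof.
move=> lt_x; rewrite reachableS; split=> [[c0 [y [c0a _ xE]]]|le_x].
  by case: y xE => [|y]; rewrite ?mulnS; lia.
by exists x, 0; split; rewrite ?muln0 ?addn0 //; apply: reachable0.
Qed.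

Lemma congr_uniq (m u v y z : nat) :
  u + m * y = v + m * z -> u <= v -> v < u + m -> u = v.
Proof.
move=> E le_uv lt_v; have [le_yz|lt_zy] := leqP y z.
  by have := leq_mul2l m y z; rewrite le_yz orbT; lia.
by have := leq_mul2l m z.+1 y; rewrite lt_zy orbT mulnS; lia.
Qed.

(** The residue [min(a_0, d_0 - 1)] is one that a single [c <= a_0] attains:
    if [a_0 < d_0] because all [c] are below [d_0], and otherwise because
    [2 d_0 - 1], the next number of residue [d_0 - 1], exceeds [a_0]. *)
Lemma reachable_shift d n a y : 0 < d 0 -> a 0 <= 2 * (d 0 - 1) ->
  reachable d n.+1 a (minn (a 0) (d 0 - 1) + d 0 * y)
  <-> reachable (shift d) n (shift a) y.
Proof.
move=> d0 a0; rewrite reachableS; split=> [[c0 [z [c0a zR E]]]|yR]; last first.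
  by exists (minn (a 0) (d 0 - 1)), y; split=> //; apply: geq_minl.
have c0E : c0 = minn (a 0) (d 0 - 1).
  have [le_c|lt_c] := leqP c0 (minn (a 0) (d 0 - 1)).
    by apply: congr_uniq (esym E) le_c _; lia.
  by apply/esym/(congr_uniq E (ltnW lt_c)); lia.
move: E; rewrite c0E => /addnI/eqP; rewrite eqn_pmul2l // => /eqP -> //.
Qed.

(** The small elements of the span give [a_0] when it is below [d_0 - 1], and
    otherwise leave [d_0] consecutive values, which the largest element tells
    apart by its residue. *)
Lemma reachable_digit0 d n a b : 2 <= d 0 ->
    a 0 <= 2 * (d 0 - 1) -> b 0 <= 2 * (d 0 - 1) ->
    (forall x, reachable d n.+1 a x <-> reachable d n.+1 b x) ->
  a 0 = b 0.
Proof.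
move=> d0 a0 b0 ab.
have small x : x < d 0 -> (x <= a 0) = (x <= b 0).
  move=> lt_x; apply/idP/idP => /(reachable_small n _ lt_x)/ab.
    by move/(reachable_small n _ lt_x).
  by move/(reachable_small n _ lt_x).
have maxE : value d n.+1 a = value d n.+1 b.
  by apply/eqP; rewrite eqn_leq !reachable_le_max //; apply/ab; apply: reachable_max.
rewrite !valueS in maxE.
have lo : (d 0 - 1 <= a 0) = (d 0 - 1 <= b 0) by apply: small; lia.
have [le_a|lt_a] := leqP (d 0 - 1) (a 0); last first.
  have sa : (a 0 <= a 0) = (a 0 <= b 0) by apply: small; lia.
  have sb : (b 0 <= a 0) = (b 0 <= b 0) by apply: small; lia.
  by apply/eqP; rewrite eqn_leq -sa sb !leqnn.
have le_b : d 0 - 1 <= b 0 by rewrite -lo.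
have [le_ab|lt_ba] := leqP (a 0) (b 0).
  by apply: congr_uniq maxE le_ab _; lia.
by apply/esym/(congr_uniq (esym maxE) (ltnW lt_ba)); lia.
Qed.

Lemma reachable_inj n d a b : (forall i, 2 <= d i) -> normal d a -> normal d b ->
    (forall x, reachable d n a x <-> reachable d n b x) ->
  forall i, i < n -> a i = b i.
Proof.
elim: n d a b => [//|n IHn] d a b hd na nb ab.
have ab0 : a 0 = b 0 by apply: reachable_digit0 ab.
have d0 : 0 < d 0 by apply: ltnW.
case=> [//|i] lt_i; apply: (IHn (shift d) (shift a) (shift b)) => // [j|j|j|x].
- exact: hd.
- exact: na.
- exact: nb.
- by rewrite -(reachable_shift _ _ d0 (na 0)) -(reachable_shift _ _ d0 (nb 0)) ab0.
Qed.

Lemma span_inj_normal d (A B : collection) : (forall i, 2 <= d i) ->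
  normal d A -> normal d B -> span d A = span d B -> A = B.
Proof.
move=> hd nA nB AB; have [m Am] := mset_bound A; have [n Bn] := mset_bound B.
have An j : maxn m n <= j -> A j = 0 by rewrite geq_max => /andP[/Am].
have Bm j : maxn m n <= j -> B j = 0 by rewrite geq_max => /andP[_ /Bn].
apply/msetP => i; have [lt_i|le_i] := ltnP i (maxn m n); last by rewrite An ?Bm.
apply: (reachable_inj hd nA nB _ lt_i) => x.
by rewrite -(spanP _ _ An) -(spanP _ _ Bm) AB.
Qed.

Theorem theorem3p2 (d : nat -> nat) (hd : forall i : nat, 2 <= d i)
    (A B : collection) :
  span d A = span d B <-> norm d A = norm d B.
Proof.
split=> [AB|nAB]; last by rewrite -(span_norm A hd) nAB span_norm.
apply: (span_inj_normal hd); [exact: normal_norm|exact: normal_norm|].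
by rewrite !span_norm.
Qed.
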